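(* Let $\mathcal{T}_e$ be a colocalizing subcategory of $\mathcal{M}^C$ with colocalizing functor $H$, and let $S_x$ be a simple $eCe$-comodule. Then $H(S_x)=S_x$ if and only if $\operatorname{Ext}^1_C(S_x,S_y)=0$ for all $y\notin I_e$, i.e., there is no arrow $S_x\to S_y$ in $\Gamma_C$ with $S_y$ a torsion simple $C$-comodule.
   Context: Let $K$ be a field and $C$ a basic $K$-coalgebra (the socle of the right $C$-comodule $C$ is a direct sum of pairwise non-isomorphic simple comodules). All comodules are right comodules, $\mathcal{M}^C$ is the category of right $C$-comodules. $\{S_x\}_{x\in I_C}$ is a complete set of pairwise non-isomorphic simple right $C$-comodules. The right Ext-quiver $\Gamma_C$ has vertex set $\{S_x\}_{x\in I_C}$ and a unique arrow $S_y\to S_x$ iff $\operatorname{Ext}^1_C(S_y,S_x)\neq 0$; it is assumed connected. Fix an idempotent $e\in C^*$. It acts on a right comodule $M$ by $em=\sum m_{(0)}e(m_{(1)})$, and on $C$ by $ec=\sum c_{(1)}e(c_{(2)})$, $ce=\sum e(c_{(1)})c_{(2)}$. The space $eCe$ is a coalgebra with $\Delta(ece)=\sum ec_{(1)}e\otimes ec_{(2)}e$ and counit the restriction of that of $C$. The quotient functor is the exact functor $T:\mathcal{M}^C\to\mathcal{M}^{eCe}$, $T(M)=eM\cong M\square_C eC$, and $\mathcal{T}_e=\{M: T(M)=0\}$ is the localizing subcategory associated to $e$. $\mathcal{T}_e$ is colocalizing if $T$ has a left adjoint $H:\mathcal{M}^{eCe}\to\mathcal{M}^C$, the colocalizing functor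 (equivalently, $eC$ is a quasi-finite right $eCe$-comodule); then $H=\operatorname{Cohom}_{eCe}(eC,-)$. Put $I_e=\{x\in I_C: T(S_x)\neq0\}$. A simple comodule $S_y$ is torsion if $T(S_y)=0$, i.e. $y\notin I_e$. The comodules $T(S_x)$, $x\in I_e$, again denoted $S_x$, form a complete set of pairwise non-isomorphic simple $eCe$-comodules; in $H(S_x)=S_x$ the left $S_x$ is the simple $eCe$-comodule, the right one the simple $C$-comodule, and equality means isomorphism of $C$-comodules. *)

(* Defs.v *)
From HB Require Import structures.
From mathcomp Require Import all_boot all_algebra.
From mathcomp Require Import boolp.
From Stdlib Require Import Relation_Operators.

Set Implicit Arguments.
Unset Strict Implicit.
Unset Printing Implicit Defensive.

Import GRing.Theory.
Local Open Scope ring_scope.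
Local Open Scope quotient_scope.

(* The tensor product of vector spaces is built from formal sums of pairs,    *)
(* two of them being identified when every bilinear map takes the same value  *)
(* on both; tensor_lift, tensor_liftE and tensor_ext are its universal        *)
(* property.                                                                  *)

Definition bilinear_map (K : fieldType) (M N V : lmodType K)
    (f : M -> N -> V) : Prop :=
  (forall m, linear (f m)) /\ (forall n, linear (f^~ n)).

Section Tensor.
Variables (K : fieldType) (M N : lmodType K).
Implicit Types (V : lmodType K) (s t : seq (M * N)).

Definition fsum_eval V (f : M -> N -> V) s : V := \sum_(p <- s) f p.1 p.2.

Definition fsum_rel s t : bool :=
  `[< forall V (f : M -> N -> V), bilinear_map f ->
      fsum_eval f s = fsum_eval f t >].

Lemma fsum_rel_refl : reflexive fsum_rel.
Proof. by move=> s; apply/asboolP. Qed.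

Lemma fsum_rel_sym : symmetric fsum_rel.
Proof. by move=> s t; apply/asboolP/asboolP => h V f bf; rewrite h. Qed.

Lemma fsum_rel_trans : transitive fsum_rel.
Proof.
move=> t s u /asboolP h1 /asboolP h2; apply/asboolP => V f bf.
by rewrite h1 // h2.
Qed.

Canonical fsum_equiv :=
  EquivRel fsum_rel fsum_rel_refl fsum_rel_sym fsum_rel_trans.

Definition tensor : Type := {eq_quot fsum_equiv}.
HB.instance Definition _ := Choice.on tensor.
HB.instance Definition _ := EqQuotient.on tensor.

Definition fsum_scale (a : K) s : seq (M * N) := [seq (a *: p.1, p.2) | p <- s].

Definition tensor_zero : tensor := \pi_tensor [::].
Definition tensor_add (x y : tensor) : tensor := \pi_tensor (repr x ++ repr y).
Definition tensor_scale (a : K) (x : tensor) : tensor :=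
  \pi_tensor (fsum_scale a (repr x)).
Definition tensor_opp (x : tensor) : tensor := tensor_scale (-1) x.

Definition tensor_eval V (f : M -> N -> V) (x : tensor) : V :=
  fsum_eval f (repr x).

Lemma tensor_eval_pi V (f : M -> N -> V) s :
  bilinear_map f -> tensor_eval f (\pi_tensor s) = fsum_eval f s.
Proof.
move=> bf; rewrite /tensor_eval.
have: repr (\pi_tensor s) = s %[mod tensor] by rewrite reprK.
by move=> /eqmodP /asboolP; exact.
Qed.

Lemma tensor_eq (x y : tensor) :
  (forall V (f : M -> N -> V), bilinear_map f ->
     tensor_eval f x = tensor_eval f y) -> x = y.
Proof.
move=> h; rewrite -[x]reprK -[y]reprK; apply/eqmodP/asboolP => V f bf.
exact: h.
Qed.

Lemma fsum_eval_scale V (f : M -> N -> V) a s : bilinear_map f ->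
  fsum_eval f (fsum_scale a s) = a *: fsum_eval f s.
Proof.
case=> _ bf; rewrite /fsum_eval big_map scaler_sumr; apply: eq_bigr => p _ /=.
have f0 : f 0 p.2 = 0.
  have := bf p.2 1 0 0; rewrite !scale1r addr0 => /eqP.
  by rewrite -subr_eq0 opprD addNKr oppr_eq0 => /eqP.
by have := bf p.2 a p.1 0; rewrite f0 !addr0.
Qed.

Lemma tensor_eval_add V (f : M -> N -> V) x y : bilinear_map f ->
  tensor_eval f (tensor_add x y) = tensor_eval f x + tensor_eval f y.
Proof. by move=> bf; rewrite tensor_eval_pi // /fsum_eval big_cat. Qed.

Lemma tensor_eval_scale V (f : M -> N -> V) a x : bilinear_map f ->
  tensor_eval f (tensor_scale a x) = a *: tensor_eval f x.
Proof. by move=> bf; rewrite tensor_eval_pi // fsum_eval_scale. Qed.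

Lemma tensor_eval_zero V (f : M -> N -> V) : bilinear_map f ->
  tensor_eval f tensor_zero = 0.
Proof. by move=> bf; rewrite tensor_eval_pi // /fsum_eval big_nil. Qed.

Let tensorE := (tensor_eval_add, tensor_eval_scale, tensor_eval_zero).

Fact tensor_addA : associative tensor_add.
Proof. by move=> x y z; apply: tensor_eq => V f bf; rewrite !tensorE // addrA. Qed.

Fact tensor_addC : commutative tensor_add.
Proof. by move=> x y; apply: tensor_eq => V f bf; rewrite !tensorE // addrC. Qed.

Fact tensor_add0 : left_id tensor_zero tensor_add.
Proof. by move=> x; apply: tensor_eq => V f bf; rewrite !tensorE // add0r. Qed.

Fact tensor_addN : left_inverse tensor_zero tensor_opp tensor_add.
Proof.
move=> x; apply: tensor_eq => V f bf.
by rewrite /tensor_opp !tensorE // scaleN1r addNr.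
Qed.

HB.instance Definition _ := GRing.isZmodule.Build tensor
  tensor_addA tensor_addC tensor_add0 tensor_addN.

Fact tensor_scaleA a b x :
  tensor_scale a (tensor_scale b x) = tensor_scale (a * b) x.
Proof. by apply: tensor_eq => V f bf; rewrite !tensorE // scalerA. Qed.

Fact tensor_scale1 : left_id 1 tensor_scale.
Proof. by move=> x; apply: tensor_eq => V f bf; rewrite !tensorE // scale1r. Qed.

Fact tensor_scaleDr : right_distributive tensor_scale +%R.
Proof. by move=> a x y; apply: tensor_eq => V f bf; rewrite !tensorE // scalerDr. Qed.

Fact tensor_scaleDl x : {morph tensor_scale^~ x : a b / a + b}.
Proof. by move=> a b; apply: tensor_eq => V f bf; rewrite !tensorE // scalerDl. Qed.

HB.instance Definition _ := GRing.Zmodule_isLmodule.Build K tensor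
  tensor_scaleA tensor_scale1 tensor_scaleDr tensor_scaleDl.

Definition pure (m : M) (n : N) : tensor := \pi_tensor [:: (m, n)].

Lemma tensor_eval_pure V (f : M -> N -> V) m n : bilinear_map f ->
  tensor_eval f (pure m n) = f m n.
Proof. by move=> bf; rewrite tensor_eval_pi // /fsum_eval big_seq1. Qed.

Lemma pure_bilinear : bilinear_map pure.
Proof.
split=> [m a n n' | n a m m'] /=; apply: tensor_eq => V f bf;
  rewrite [in RHS]tensor_eval_add // [in RHS]tensor_eval_scale //;
  by rewrite !tensor_eval_pure //; case: bf => b1 b2; rewrite ?b1 // b2.
Qed.

HB.instance Definition _ (m : M) :=
  GRing.isLinear.Build K N tensor *:%R (pure m) (pure_bilinear.1 m).

Definition purer (n : N) (m : M) : tensor := pure m n.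
HB.instance Definition _ (n : N) :=
  GRing.isLinear.Build K M tensor *:%R (purer n) (pure_bilinear.2 n).

Lemma pureZl a m n : pure (a *: m) n = a *: pure m n.
Proof. exact: (linearZZ (purer n)). Qed.

Lemma pureZr a m n : pure m (a *: n) = a *: pure m n.
Proof. exact: linearZ. Qed.

Lemma pureDl m m' n : pure (m + m') n = pure m n + pure m' n.
Proof. exact: (linearD (purer n)). Qed.

Lemma pureDr m n n' : pure m (n + n') = pure m n + pure m n'.
Proof. exact: linearD. Qed.

Definition tensor_lift V (f : M -> N -> V) (bf : bilinear_map f) : tensor -> V :=
  tensor_eval f.

Fact tensor_lift_linear V (f : M -> N -> V) (bf : bilinear_map f) :
  linear (tensor_lift bf).
Proof.
by move=> a x y; rewrite /tensor_lift tensor_eval_add // tensor_eval_scale.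
Qed.
HB.instance Definition _ V (f : M -> N -> V) (bf : bilinear_map f) :=
  GRing.isLinear.Build K tensor V *:%R (tensor_lift bf) (tensor_lift_linear bf).

Lemma tensor_liftE V (f : M -> N -> V) (bf : bilinear_map f) m n :
  tensor_lift bf (pure m n) = f m n.
Proof. exact: tensor_eval_pure. Qed.

Lemma tensor_sum (x : tensor) : x = \sum_(p <- repr x) pure p.1 p.2.
Proof.
rewrite -[LHS]reprK; elim: (repr x) => [|[m n] s IHs]; first by rewrite big_nil.
rewrite big_cons -IHs; apply: tensor_eq => V f bf.
by rewrite tensor_eval_add // !tensor_eval_pi // /fsum_eval big_cons big_seq1.
Qed.

Lemma tensor_ext V (f g : {linear tensor -> V}) :
  (forall m n, f (pure m n) = g (pure m n)) -> f =1 g.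
Proof.
by move=> h x; rewrite (tensor_sum x) !linear_sum; apply: eq_bigr => p _.
Qed.

End Tensor.

Notation "M ⊗ N" := (tensor M N) (at level 40, left associativity).
Notation "m *t n" := (pure m n) (at level 40, left associativity).

Section TensorMaps.
Variable K : fieldType.
Implicit Types M N P V W : lmodType K.

Fact tmap_bilinear M N V W (f : {linear M -> V}) (g : {linear N -> W}) :
  bilinear_map (fun m n => f m *t g n).
Proof.
have [b1 b2] := pure_bilinear V W.
by split=> [m a n n' | n a m m'] /=; rewrite linearP ?b1 ?b2.
Qed.

Definition tmap M N V W (f : {linear M -> V}) (g : {linear N -> W}) :
  M ⊗ N -> V ⊗ W := tensor_lift (tmap_bilinear f g).
HB.instance Definition _ M N V W (f : {linear M -> V}) (g : {linear N -> W}) :=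
  GRing.isLinear.Build K _ _ *:%R (tmap f g)
    (tensor_lift_linear (tmap_bilinear f g)).

Lemma tmapE M N V W (f : {linear M -> V}) (g : {linear N -> W}) m n :
  tmap f g (m *t n) = f m *t g n.
Proof. exact: tensor_liftE. Qed.

Fact contractr_bilinear M N (f : {scalar N}) :
  bilinear_map (fun (m : M) (n : N) => f n *: m).
Proof.
split=> [m a n n' | n a m m'] /=.
  by rewrite linearP scalerDl scalerA.
by rewrite scalerDr !scalerA mulrC.
Qed.

Fact contractl_bilinear M N (f : {scalar N}) :
  bilinear_map (fun (n : N) (m : M) => f n *: m).
Proof. by have [b1 b2] := contractr_bilinear M f; split. Qed.

Definition contractr M N (f : {scalar N}) : M ⊗ N -> M :=
  tensor_lift (contractr_bilinear M f).
Arguments contractr M {N} f.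
HB.instance Definition _ M N (f : {scalar N}) :=
  GRing.isLinear.Build K _ _ *:%R (contractr M f)
    (tensor_lift_linear (contractr_bilinear M f)).

Definition contractl M N (f : {scalar N}) : N ⊗ M -> M :=
  tensor_lift (contractl_bilinear M f).
Arguments contractl M {N} f.
HB.instance Definition _ M N (f : {scalar N}) :=
  GRing.isLinear.Build K _ _ *:%R (contractl M f)
    (tensor_lift_linear (contractl_bilinear M f)).

Lemma contractrE M N (f : {scalar N}) (m : M) n :
  contractr M f (m *t n) = f n *: m.
Proof. exact: tensor_liftE. Qed.

Lemma contractlE M N (f : {scalar N}) (m : M) n :
  contractl M f (n *t m) = f n *: m.
Proof. exact: tensor_liftE. Qed.

Fact tassoc1_bilinear M N P (p : P) :
  bilinear_map (fun (m : M) (n : N) => m *t (n *t p)).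
Proof.
have [b1 b2] := pure_bilinear M (N ⊗ P); have [c1 c2] := pure_bilinear N P.
by split=> [m a n n' | n a m m'] /=; rewrite ?c2 ?b1 ?b2.
Qed.

Fact tassoc_bilinear M N P :
  bilinear_map (fun (x : M ⊗ N) (p : P) => tensor_lift (tassoc1_bilinear M N p) x).
Proof.
split=> [x a p p' | p a x x']; last exact: linearP.
have [b1 b2] := pure_bilinear M (N ⊗ P); have [c1 c2] := pure_bilinear N P.
rewrite /= (tensor_sum x) !(linear_sum (tensor_lift _)) scaler_sumr -big_split.
apply: eq_bigr => q _ /=.
by rewrite !tensor_liftE c1 b1.
Qed.

Definition tassoc M N P : (M ⊗ N) ⊗ P -> M ⊗ (N ⊗ P) :=
  tensor_lift (tassoc_bilinear M N P).
Arguments tassoc M N P : clear implicits.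
HB.instance Definition _ M N P :=
  GRing.isLinear.Build K _ _ *:%R (tassoc M N P)
    (tensor_lift_linear (tassoc_bilinear M N P)).

Lemma tassocE M N P (m : M) (n : N) (p : P) :
  tassoc M N P (m *t n *t p) = m *t (n *t p).
Proof. by rewrite /tassoc /= !tensor_liftE. Qed.

Lemma tensor3_ext M N P V (f g : {linear (M ⊗ N) ⊗ P -> V}) :
  (forall m n p, f (m *t n *t p) = g (m *t n *t p)) -> f =1 g.
Proof.
move=> h; apply: tensor_ext => x p; rewrite (tensor_sum x).
have -> : (\sum_(q <- repr x) q.1 *t q.2) *t p =
    \sum_(q <- repr x) (q.1 *t q.2 *t p) by exact: (linear_sum (purer p)).
by rewrite !linear_sum; apply: eq_bigr => q _.
Qed.

End TensorMaps.
Arguments contractr {K} M {N} f.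
Arguments contractl {K} M {N} f.
Arguments tassoc {K} M N P.

Section TensorCalculus.
Variable K : fieldType.
Implicit Types M N P V W X Y : lmodType K.

Lemma tmap_comp M N V W X Y (f : {linear M -> V}) (g : {linear N -> W})
    (f' : {linear V -> X}) (g' : {linear W -> Y}) t :
  tmap f' g' (tmap f g t) = tmap (f' \o f) (g' \o g) t.
Proof.
apply: (tensor_ext (f := tmap f' g' \o tmap f g)) => m n /=.
by rewrite !tmapE.
Qed.

Lemma eq_tmap M N V W (f f' : {linear M -> V}) (g g' : {linear N -> W}) :
  f =1 f' -> g =1 g' -> tmap f g =1 tmap f' g'.
Proof. by move=> ef eg; apply: tensor_ext => m n /=; rewrite !tmapE ef eg. Qed.

Lemma tmap_id M N (t : M ⊗ N) : tmap idfun idfun t = t.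
Proof.
apply: (tensor_ext (f := tmap idfun idfun) (g := idfun)) => m n /=.
by rewrite tmapE.
Qed.

Lemma tassoc_tmap M N P V W X (f : {linear M -> V}) (g : {linear N -> W})
    (h : {linear P -> X}) t :
  tassoc _ _ _ (tmap (tmap f g) h t) = tmap f (tmap g h) (tassoc _ _ _ t).
Proof.
apply: (tensor3_ext (f := tassoc V W X \o tmap (tmap f g) h)
  (g := tmap f (tmap g h) \o tassoc M N P)) => m n p /=.
by do 3 rewrite ?tmapE ?tassocE /=.
Qed.

Lemma contractr_tmap M N V W (f : {linear M -> V}) (g : {linear N -> W})
    (a : {scalar W}) t :
  contractr V a (tmap f g t) = f (contractr M (a \o g) t).
Proof.
apply: (tensor_ext (f := contractr V a \o tmap f g)
  (g := f \o contractr M (a \o g))) => m n /=.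
by rewrite tmapE !contractrE linearZ.
Qed.

Lemma contractl_tmap M N V W (f : {linear M -> V}) (g : {linear N -> W})
    (a : {scalar W}) t :
  contractl V a (tmap g f t) = f (contractl M (a \o g) t).
Proof.
apply: (tensor_ext (f := contractl V a \o tmap g f)
  (g := f \o contractl M (a \o g))) => m n /=.
by rewrite tmapE !contractlE linearZ.
Qed.

Lemma eq_contractr M N (a b : {scalar N}) : a =1 b ->
  contractr M a =1 contractr M b.
Proof. by move=> h; apply: tensor_ext => m n /=; rewrite !contractrE h. Qed.

Lemma eq_contractl M N (a b : {scalar N}) : a =1 b ->
  contractl M a =1 contractl M b.
Proof. by move=> h; apply: tensor_ext => m n /=; rewrite !contractlE h. Qed.

Lemma contractr_assoc M N P (a : {scalar P}) t :
  contractr (M ⊗ N) a t = tmap idfun (contractr N a) (tassoc M N P t).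
Proof.
apply: (tensor3_ext (f := contractr (M ⊗ N) a)
  (g := tmap idfun (contractr N a) \o tassoc M N P)) => m n p /=.
by rewrite contractrE tassocE tmapE /= contractrE pureZr.
Qed.

Lemma contractl_assoc M N P (a : {scalar M}) t :
  contractl (N ⊗ P) a (tassoc M N P t) = tmap (contractl N a) idfun t.
Proof.
apply: (tensor3_ext (f := contractl (N ⊗ P) a \o tassoc M N P)
  (g := tmap (contractl N a) idfun)) => m n p /=.
by rewrite tassocE tmapE /= !contractlE pureZl.
Qed.

Lemma contract_mid M N P (a : {scalar N}) t :
  tmap idfun (contractl P a) (tassoc M N P t) = tmap (contractr M a) idfun t.
Proof.
apply: (tensor3_ext (f := tmap idfun (contractl P a) \o tassoc M N P)
  (g := tmap (contractr M a) idfun)) => m n p /=.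
by rewrite tassocE !tmapE /= contractlE contractrE pureZl pureZr.
Qed.

End TensorCalculus.

Record coalgebra (K : fieldType) := Coalgebra {
  coalg_sort :> lmodType K;
  comul : {linear coalg_sort -> coalg_sort ⊗ coalg_sort};
  counit : {scalar coalg_sort};
  comulA : forall c, tassoc _ _ _ (tmap comul idfun (comul c))
                     = tmap idfun comul (comul c);
  counitl : forall c, contractl coalg_sort counit (comul c) = c;
  counitr : forall c, contractr coalg_sort counit (comul c) = c }.

Record comodule (K : fieldType) (C : coalgebra K) := Comodule {
  comod_sort :> lmodType K;
  coact : {linear comod_sort -> comod_sort ⊗ C};
  coactA : forall m, tassoc _ _ _ (tmap coact idfun (coact m))
                     = tmap idfun (comul C) (coact m);
  coact_counit : forall m, contractr comod_sort (counit C) (coact m) = m }.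

Definition regular_comodule (K : fieldType) (C : coalgebra K) : comodule C :=
  @Comodule K C C (comul C) (@comulA K C) (@counitr K C).

Record comod_hom (K : fieldType) (C : coalgebra K) (M N : comodule C) :=
  ComodHom {
    hom_fun :> {linear M -> N};
    hom_coact : forall m, coact N (hom_fun m) = tmap hom_fun idfun (coact M m) }.

Section Comodules.
Variables (K : fieldType) (C : coalgebra K).
Implicit Types M N P : comodule C.

Lemma linear_ext (U V : lmodType K) (f g : {linear U -> V}) : f =1 g -> f = g.
Proof.
case: f g => [f [[a1] [b1]]] [g [[a2] [b2]]] /= /funext E.
case: _ / E a2 b2 => a2 b2.
by rewrite (Prop_irrelevance a1 a2) (Prop_irrelevance b1 b2).
Qed.

Lemma comod_hom_ext M N (f g : comod_hom M N) : f =1 g -> f = g.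
Proof.
case: f g => [f hf] [g hg] /= /linear_ext E.
by case: _ / E hg => hg; rewrite (Prop_irrelevance hf hg).
Qed.

Fact hom_id_coact M (m : M) :
  coact M (idfun m) = tmap idfun idfun (coact M m).
Proof. by rewrite tmap_id. Qed.

Definition hom_id M : comod_hom M M := ComodHom (hom_id_coact (M := M)).

Fact hom_comp_coact M N P (g : comod_hom N P) (f : comod_hom M N) (m : M) :
  coact P ((g \o f) m) = tmap (g \o f) idfun (coact M m).
Proof. by rewrite /= !hom_coact tmap_comp. Qed.

Definition hom_comp M N P (g : comod_hom N P) (f : comod_hom M N) :
  comod_hom M P := ComodHom (hom_comp_coact g f).

Definition is_zero M : Prop := forall m : M, m = 0.

Definition comod_iso M N : Prop :=
  exists (f : comod_hom M N) (g : comod_hom N M), cancel f g /\ cancel g f.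

(* Subcomodules are taken up to isomorphism, as injective homomorphisms.      *)
Definition simple_comodule M : Prop :=
  ~ is_zero M /\
  forall N (f : comod_hom N M), injective f ->
    is_zero N \/ (forall m, exists n, f n = m).

Definition complete_simples (I : Type) (S : I -> comodule C) : Prop :=
  [/\ forall x, simple_comodule (S x),
      forall x y, comod_iso (S x) (S y) -> x = y
    & forall M, simple_comodule M -> exists x, comod_iso M (S x)].

Definition socle M (m : M) : Prop :=
  exists (n : nat) (N : 'I_n -> comodule C) (f : forall i, comod_hom (N i) M)
         (u : forall i, N i),
    (forall i, simple_comodule (N i) /\ injective (f i)) /\ m = \sum_i f i (u i).

(* The subspace U of M is the internal direct sum of the images of the j i.   *)
Definition direct_sum_of M (U : M -> Prop) (I : Type) (N : I -> comodule C)
    (j : forall i, comod_hom (N i) M) : Prop :=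
  [/\ forall i, injective (j i),
      forall m, U m <-> exists (n : nat) (k : 'I_n -> I) (u : forall a, N (k a)),
                          m = \sum_a j (k a) (u a)
    & forall (n : nat) (k : 'I_n -> I) (u : forall a, N (k a)), injective k ->
        \sum_a j (k a) (u a) = 0 -> forall a, u a = 0].

Definition basic_coalgebra : Prop :=
  exists (I : Type) (N : I -> comodule C)
         (j : forall i, comod_hom (N i) (regular_comodule C)),
    [/\ forall i, simple_comodule (N i),
        forall i i', comod_iso (N i) (N i') -> i = i'
      & direct_sum_of (socle (M := regular_comodule C)) j].

End Comodules.

Section DirectSum.
Variables (K : fieldType) (C : coalgebra K) (N M : comodule C).

Definition dsum_inl (n : N) : (N * M)%type := (n, 0).
Definition dsum_inr (m : M) : (N * M)%type := (0, m).
Definition dsum_fst (z : (N * M)%type) : N := z.1.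
Definition dsum_snd (z : (N * M)%type) : M := z.2.

Fact dsum_inl_linear : linear dsum_inl.
Proof. by move=> a u v; congr pair; rewrite /= scaler0 addr0. Qed.
HB.instance Definition _ :=
  GRing.isLinear.Build K N (N * M)%type *:%R dsum_inl dsum_inl_linear.
Fact dsum_inr_linear : linear dsum_inr.
Proof. by move=> a u v; congr pair; rewrite /= scaler0 addr0. Qed.
HB.instance Definition _ :=
  GRing.isLinear.Build K M (N * M)%type *:%R dsum_inr dsum_inr_linear.
Fact dsum_fst_linear : linear dsum_fst. Proof. by []. Qed.
HB.instance Definition _ :=
  GRing.isLinear.Build K (N * M)%type N *:%R dsum_fst dsum_fst_linear.
Fact dsum_snd_linear : linear dsum_snd. Proof. by []. Qed.
HB.instance Definition _ :=
  GRing.isLinear.Build K (N * M)%type M *:%R dsum_snd dsum_snd_linear.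

Definition dsum_coact (z : (N * M)%type) : (N * M)%type ⊗ C :=
  tmap dsum_inl idfun (coact N z.1) + tmap dsum_inr idfun (coact M z.2).

Fact dsum_coact_linear : linear dsum_coact.
Proof.
by move=> a u v; rewrite /dsum_coact /= !linearP /= scalerDr addrACA.
Qed.
HB.instance Definition _ :=
  GRing.isLinear.Build K (N * M)%type _ *:%R dsum_coact dsum_coact_linear.

Fact dsum_coact_inl n : dsum_coact (dsum_inl n) = tmap dsum_inl idfun (coact N n).
Proof. by rewrite /dsum_coact /= !linear0 addr0. Qed.

Fact dsum_coact_inr m : dsum_coact (dsum_inr m) = tmap dsum_inr idfun (coact M m).
Proof. by rewrite /dsum_coact /= !linear0 add0r. Qed.

Fact dsum_coactA z :
  tassoc _ _ _ (tmap dsum_coact idfun (dsum_coact z))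
  = tmap idfun (comul C) (dsum_coact z).
Proof.
rewrite {2 3}/dsum_coact !linearD /= !tmap_comp; congr (_ + _).
- rewrite (eq_tmap (f' := tmap dsum_inl idfun \o coact N) (g' := idfun \o idfun)) //;
    last exact: dsum_coact_inl.
  rewrite -(tmap_comp (coact N) idfun (tmap dsum_inl idfun) idfun) tassoc_tmap coactA tmap_comp.
  by apply: eq_tmap => // c /=; rewrite tmap_id.
- rewrite (eq_tmap (f' := tmap dsum_inr idfun \o coact M) (g' := idfun \o idfun)) //;
    last exact: dsum_coact_inr.
  rewrite -(tmap_comp (coact M) idfun (tmap dsum_inr idfun) idfun) tassoc_tmap coactA tmap_comp.
  by apply: eq_tmap => // c /=; rewrite tmap_id.
Qed.

Fact dsum_coact_counit z :
  contractr (N * M)%type (counit C) (dsum_coact z) = z.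
Proof.
rewrite linearD /= !contractr_tmap /=.
rewrite (eq_contractr (b := counit C)) // coact_counit.
rewrite (eq_contractr (b := counit C)) // coact_counit.
by case: z => n m; congr pair; rewrite /= ?addr0 ?add0r.
Qed.

Definition dsum : comodule C := Comodule dsum_coactA dsum_coact_counit.

Definition dsum_inl_hom : comod_hom N dsum :=
  @ComodHom K C N dsum dsum_inl dsum_coact_inl.

Fact dsum_snd_coact (z : dsum) :
  coact M (dsum_snd z) = tmap dsum_snd idfun (coact dsum z).
Proof.
rewrite /= linearD /= !tmap_comp.
have -> : tmap (dsum_snd \o dsum_inl) (idfun \o idfun) (coact N z.1) = 0.
  rewrite (tensor_sum (coact N z.1)) linear_sum big1 // => p _.
  by rewrite /= tmapE; exact: (linear0 (purer _)).
rewrite add0r -[LHS]tmap_id; exact: eq_tmap.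
Qed.

Definition dsum_snd_hom : comod_hom dsum M :=
  @ComodHom K C dsum M dsum_snd dsum_snd_coact.

End DirectSum.

Record extension (K : fieldType) (C : coalgebra K) (M N : comodule C) :=
  Extension {
    ext_mid : comodule C;
    ext_in : comod_hom N ext_mid;
    ext_out : comod_hom ext_mid M;
    ext_in_inj : injective ext_in;
    ext_out_surj : forall m, exists z, ext_out z = m;
    ext_exact : forall z, ext_out z = 0 <-> exists n, ext_in n = z }.

Section Ext1.
Variables (K : fieldType) (C : coalgebra K).

Fact dsum_in_inj (M N : comodule C) : injective (dsum_inl_hom N M).
Proof. by move=> n n' []. Qed.

Fact dsum_out_surj (M N : comodule C) (m : M) :
  exists z, dsum_snd_hom N M z = m.
Proof. by exists (0, m). Qed.

Fact dsum_exact (M N : comodule C) (z : dsum N M) :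
  dsum_snd_hom N M z = 0 <-> exists n, dsum_inl_hom N M n = z.
Proof.
split=> [|[n <-]] //; case: z => n m /= m0; exists n.
by rewrite /= /dsum_inl -[X in (_, X)]m0.
Qed.

Definition split_extension (M N : comodule C) : extension M N :=
  Extension (@dsum_in_inj M N) (@dsum_out_surj M N) (@dsum_exact M N).

Definition ext_equiv (M N : comodule C) (E F : extension M N) : Prop :=
  exists (f : comod_hom (ext_mid E) (ext_mid F))
         (g : comod_hom (ext_mid F) (ext_mid E)),
    [/\ cancel f g /\ cancel g f,
        forall n, f (ext_in E n) = ext_in F n
      & forall z, ext_out F (f z) = ext_out E z].

(* Ext^1_C(M, N) as the set of Yoneda classes of extensions                   *)
(* 0 -> N -> E -> M -> 0.                                                     *)
Definition Ext1 (M N : comodule C) :=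
  {X : extension M N -> Prop | exists E, X = ext_equiv E}.

Definition ext_class (M N : comodule C) (E : extension M N) : Ext1 M N :=
  exist _ (ext_equiv E) (ex_intro _ E erefl).

(* The zero of Ext^1 (neutral for the Baer sum) is the class of the split     *)
(* extension.                                                                 *)
Definition Ext1_eq0 (M N : comodule C) : Prop :=
  forall X : Ext1 M N, X = ext_class (split_extension M N).

(* An arrow S x -> S y of the right Ext-quiver.                               *)
Definition ext_arrow (I : Type) (S : I -> comodule C) (x y : I) : Prop :=
  ~ Ext1_eq0 (S x) (S y).

Definition ext_quiver_connected (I : Type) (S : I -> comodule C) : Prop :=
  forall x y, clos_refl_sym_trans I (ext_arrow S) x y.

End Ext1.

Section Fixed.
Variables (K : fieldType) (M : lmodType K) (p : {linear M -> M}).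

Definition fixpred : pred M := fun m => p m == m.

Fact fixpred_submod : submod_closed fixpred.
Proof.
split=> [|a u v]; rewrite !unfold_in /fixpred ?linear0 //.
by move=> /eqP pu /eqP pv; rewrite linearP pu pv.
Qed.
HB.instance Definition _ :=
  GRing.isSubmodClosed.Build K M fixpred fixpred_submod.

(* For idempotent p this is the image of p. *)
Record fixed := Fixed { fixed_val : M; fixed_valP : fixed_val \in fixpred }.
HB.instance Definition _ := [isSub for fixed_val].
HB.instance Definition _ := [Choice of fixed by <:].
HB.instance Definition _ := [SubChoice_isSubLmodule of fixed by <:].

Lemma fixedP (m : fixed) : p (val m) = val m.
Proof. by case: m => m /= /eqP. Qed.

Variable pp : forall m, p (p m) = p m.

Fact fixed_proj_subproof m : p m \in fixpred.
Proof. by rewrite unfold_in /fixpred pp. Qed.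

Definition fixed_proj (m : M) : fixed := Fixed (fixed_proj_subproof m).

Fact fixed_proj_linear : linear fixed_proj.
Proof. by move=> a u v; apply: val_inj; rewrite /= !linearP. Qed.
HB.instance Definition _ :=
  GRing.isLinear.Build K M fixed *:%R fixed_proj fixed_proj_linear.

Lemma fixed_projK (m : fixed) : fixed_proj (val m) = m.
Proof. by apply: val_inj; rewrite /= fixedP. Qed.

Lemma eq_fixed_proj m m' : p m = p m' -> fixed_proj m = fixed_proj m'.
Proof. by move=> h; apply: val_inj. Qed.

End Fixed.

Section Idempotent.
Variables (K : fieldType) (C : coalgebra K).

Fact conv_bilinear (f g : {scalar C}) :
  bilinear_map (fun a b : C => f a * g b : K^o).
Proof.
split=> [x a b b' | x a b b'] /=; rewrite linearP.
  by rewrite mulrDr mulrCA.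
by rewrite mulrDl -mulrA.
Qed.

(* The product of the dual algebra: (f * g)(c) = \sum f(c_1) g(c_2). *)
Definition conv (f g : {scalar C}) (c : C) : K :=
  tensor_lift (conv_bilinear f g) (comul C c).

Definition conv_idempotent (e : {scalar C}) : Prop := conv e e =1 e.

(* e m = \sum m_(0) e(m_(1)); on C itself, e c = \sum c_(1) e(c_(2)). *)
Definition act (e : {scalar C}) (M : comodule C) (m : M) : M :=
  contractr M e (coact M m).
HB.instance Definition _ e (M : comodule C) := GRing.isLinear.Build K M M *:%R
  (@act e M) (fun a u v => linearP (contractr M e \o coact M) a u v).

(* c e = \sum e(c_(1)) c_(2) *)
Definition ract (e : {scalar C}) (c : C) : C := contractl C e (comul C c).
HB.instance Definition _ e := GRing.isLinear.Build K C C *:%R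
  (ract e) (fun a u v => linearP (contractl C e \o comul C) a u v).

Definition lact (e : {scalar C}) (c : C) : C := act e (M := regular_comodule C) c.
HB.instance Definition _ e := GRing.isLinear.Build K C C *:%R
  (lact e) (fun a u v => linearP (contractr C e \o comul C) a u v).

(* c |-> e c e *)
Definition corner (e : {scalar C}) (c : C) : C := lact e (ract e c).
HB.instance Definition _ e := GRing.isLinear.Build K C C *:%R
  (corner e) (fun a u v => linearP (lact e \o ract e) a u v).

Lemma conv_lact f g c : conv f g c = f (lact g c).
Proof.
apply: (tensor_ext (f := tensor_lift (conv_bilinear f g)) (V := K^o)
  (g := f \o contractr C g)) => a b /=.
by rewrite tensor_liftE contractrE linearZ /= mulrC.
Qed.

Lemma conv_ract f g c : conv f g c = g (ract f c).
Proof.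
apply: (tensor_ext (f := tensor_lift (conv_bilinear f g)) (V := K^o)
  (g := g \o contractl C f)) => a b /=.
by rewrite tensor_liftE contractlE linearZ.
Qed.

Lemma coact_act e (M : comodule C) (m : M) :
  coact M (act e m) = tmap idfun (lact e) (coact M m).
Proof.
have -> : coact M (act e m) = contractr _ e (tmap (coact M) idfun (coact M m)).
  by rewrite contractr_tmap /=; congr (coact M _); apply: eq_contractr.
rewrite contractr_assoc coactA tmap_comp; exact: eq_tmap.
Qed.

Lemma comul_ract e c : comul C (ract e c) = tmap (ract e) idfun (comul C c).
Proof.
have -> : comul C (ract e c) = contractl _ e (tmap idfun (comul C) (comul C c)).
  by rewrite contractl_tmap /=; congr (comul C _); apply: eq_contractl.
rewrite -comulA contractl_assoc tmap_comp; exact: eq_tmap.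
Qed.

Lemma comul_lact e c : comul C (lact e c) = tmap idfun (lact e) (comul C c).
Proof. exact: (coact_act e (M := regular_comodule C)). Qed.

Lemma lact_ract e c : lact e (ract e c) = ract e (lact e c).
Proof.
by rewrite /lact /act /= comul_ract contractr_tmap; congr (ract e _).
Qed.

Variables (e : {scalar C}) (he : conv_idempotent e).

Lemma act_idem (M : comodule C) (m : M) : act e (act e m) = act e m.
Proof.
rewrite {1}/act coact_act contractr_tmap /=; apply: eq_contractr => c /=.
by rewrite -conv_lact he.
Qed.

Lemma lact_idem c : lact e (lact e c) = lact e c.
Proof. exact: (act_idem (M := regular_comodule C)). Qed.

Lemma ract_idem c : ract e (ract e c) = ract e c.
Proof.
rewrite {1}/ract comul_ract contractl_tmap /=; apply: eq_contractl => d /=.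
by rewrite -conv_ract he.
Qed.

Lemma corner_idem c : corner e (corner e c) = corner e c.
Proof. by rewrite /corner -lact_ract lact_idem ract_idem. Qed.

Lemma corner_lact c : corner e (lact e c) = corner e c.
Proof. by rewrite /corner -lact_ract lact_idem. Qed.

Lemma corner_ract c : corner e (ract e c) = corner e c.
Proof. by rewrite /corner ract_idem. Qed.

Lemma counit_corner c : counit C (corner e c) = e c.
Proof.
have h d : counit C (lact e d) = e d.
  rewrite /lact /act /= -[in RHS](counitl d).
  apply: (tensor_ext (f := counit C \o contractr C e) (V := K^o)
    (g := e \o contractl C (counit C))) => a b /=.
  by rewrite contractrE contractlE !scalarZ mulrC.
by rewrite h -conv_ract he.
Qed.

Notation eC := (fixed (corner e)).
Notation pi := (fixed_proj corner_idem).

Definition corner_comul (x : eC) : eC ⊗ eC := tmap pi pi (comul C (val x)).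
HB.instance Definition _ := GRing.isLinear.Build K eC (eC ⊗ eC) *:%R
  corner_comul (fun a u v => linearP (tmap pi pi \o comul C \o val) a u v).

Definition corner_counit (x : eC) : K := counit C (val x).
HB.instance Definition _ := GRing.isLinear.Build K eC K *%R
  corner_counit (fun a u v => linearP (counit C \o val) a u v).

Lemma corner_comul_pi c : corner_comul (pi c) = tmap pi pi (comul C c).
Proof.
rewrite /corner_comul /= /corner comul_lact comul_ract !tmap_comp.
apply: eq_tmap => a /=; apply: eq_fixed_proj; first exact: corner_ract.
exact: corner_lact.
Qed.

Fact corner_comulA x :
  tassoc _ _ _ (tmap corner_comul idfun (corner_comul x))
  = tmap idfun corner_comul (corner_comul x).
Proof.
rewrite {2 4}/corner_comul !tmap_comp.
rewrite (eq_tmap (f' := tmap pi pi \o comul C) (g' := pi \o idfun)) //;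
  last exact: corner_comul_pi.
rewrite -(tmap_comp (comul C) idfun (tmap pi pi) pi) tassoc_tmap comulA tmap_comp.
by apply: eq_tmap => // c /=; rewrite corner_comul_pi.
Qed.

Fact corner_counitl x : contractl _ corner_counit (corner_comul x) = x.
Proof.
rewrite /corner_comul contractl_tmap (eq_contractl (b := e)); last first.
  by move=> c; exact: counit_corner.
rewrite -[RHS](fixed_projK corner_idem); apply: eq_fixed_proj.
exact: corner_ract.
Qed.

Fact corner_counitr x : contractr _ corner_counit (corner_comul x) = x.
Proof.
rewrite /corner_comul contractr_tmap (eq_contractr (b := e)); last first.
  by move=> c; exact: counit_corner.
rewrite -[RHS](fixed_projK corner_idem); apply: eq_fixed_proj.
exact: corner_lact.
Qed.

(* eCe, with comultiplication e c e |-> \sum e c_(1) e ⊗ e c_(2) e *)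
Definition corner_coalgebra : coalgebra K :=
  Coalgebra corner_comulA corner_counitl corner_counitr.

Section QuotientObject.
Variable M : comodule C.
Notation eM := (fixed (act e (M := M))).
Notation piM := (fixed_proj (act_idem (M := M))).

(* e m |-> \sum e m_(0) ⊗ e m_(1) e *)
Definition quotient_coact (x : eM) : eM ⊗ corner_coalgebra :=
  tmap piM pi (coact M (val x)).
HB.instance Definition _ :=
  GRing.isLinear.Build K eM (eM ⊗ corner_coalgebra) *:%R
  quotient_coact (fun a u v => linearP (tmap piM pi \o coact M \o val) a u v).

Lemma quotient_coact_pi m : quotient_coact (piM m) = tmap piM pi (coact M m).
Proof.
rewrite /quotient_coact /= coact_act tmap_comp; apply: eq_tmap => // c /=.
by apply: eq_fixed_proj; exact: corner_lact.
Qed.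

Fact quotient_coactA x :
  tassoc _ _ _ (tmap quotient_coact idfun (quotient_coact x))
  = tmap idfun (comul corner_coalgebra) (quotient_coact x).
Proof.
rewrite {2 3}/quotient_coact !tmap_comp.
rewrite (eq_tmap (f' := tmap piM pi \o coact M) (g' := pi \o idfun)) //;
  last exact: quotient_coact_pi.
rewrite -(tmap_comp (coact M) idfun (tmap piM pi) pi) tassoc_tmap coactA tmap_comp.
by apply: eq_tmap => // c /=; rewrite corner_comul_pi.
Qed.

Fact quotient_coact_counit x :
  contractr _ (counit corner_coalgebra) (quotient_coact x) = x.
Proof.
rewrite /quotient_coact contractr_tmap (eq_contractr (b := e)); last first.
  by move=> c; exact: counit_corner.
rewrite -[RHS](fixed_projK (act_idem (M := M))); apply: eq_fixed_proj.
exact: act_idem.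
Qed.

Definition quotient_obj : comodule corner_coalgebra :=
  Comodule quotient_coactA quotient_coact_counit.

End QuotientObject.

Lemma hom_act (M N : comodule C) (f : comod_hom M N) (m : M) :
  f (act e m) = act e (f m).
Proof.
rewrite /act hom_coact contractr_tmap; congr (f _); exact: eq_contractr.
Qed.

Section QuotientMap.
Variables (M N : comodule C) (f : comod_hom M N).

Fact quotient_fun_subproof (x : quotient_obj M) :
  f (val x) \in fixpred (act e (M := N)).
Proof. by rewrite unfold_in /fixpred /= -hom_act (fixedP x). Qed.

Definition quotient_fun (x : quotient_obj M) : quotient_obj N :=
  Fixed (quotient_fun_subproof x).

Fact quotient_fun_linear : linear quotient_fun.
Proof. by move=> a u v; apply: val_inj; rewrite /= !linearP. Qed.
HB.instance Definition _ :=
  GRing.isLinear.Build K (quotient_obj M) (quotient_obj N) *:%R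
    quotient_fun quotient_fun_linear.

Fact quotient_fun_coact x :
  coact (quotient_obj N) (quotient_fun x)
  = tmap quotient_fun idfun (coact (quotient_obj M) x).
Proof.
rewrite /= /quotient_coact /= hom_coact !tmap_comp; apply: eq_tmap => // m /=.
by apply: val_inj; rewrite /= hom_act.
Qed.

Definition quotient_map : comod_hom (quotient_obj M) (quotient_obj N) :=
  ComodHom quotient_fun_coact.
End QuotientMap.

End Idempotent.

Record comod_functor (K : fieldType) (C D : coalgebra K) := ComodFunctor {
  fobj :> comodule C -> comodule D;
  fmap : forall M N, comod_hom M N -> comod_hom (fobj M) (fobj N);
  fmap_id : forall M, fmap (hom_id M) = hom_id (fobj M);
  fmap_comp : forall M N P (g : comod_hom N P) (f : comod_hom M N),
    fmap (hom_comp g f) = hom_comp (fmap g) (fmap f) }.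

Record adjunction (K : fieldType) (C D : coalgebra K)
    (H : comod_functor D C) (T : comod_functor C D) := Adjunction {
  adj_fun : forall N M, comod_hom (H N) M -> comod_hom N (T M);
  adj_bij : forall N M, bijective (@adj_fun N M);
  adj_nat : forall N N' M M' (h : comod_hom N' N) (g : comod_hom M M')
                   (f : comod_hom (H N) M),
    adj_fun (hom_comp g (hom_comp f (fmap H h)))
    = hom_comp (fmap T g) (hom_comp (adj_fun f) h) }.

Section Quotient.
Variables (K : fieldType) (C : coalgebra K).
Variables (e : {scalar C}) (he : conv_idempotent e).

Fact quotient_map_id (M : comodule C) :
  quotient_map he (hom_id M) = hom_id (quotient_obj he M).
Proof. by apply: comod_hom_ext => x; apply: val_inj. Qed.

Fact quotient_map_comp (M N P : comodule C) (g : comod_hom N P)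
    (f : comod_hom M N) :
  quotient_map he (hom_comp g f)
  = hom_comp (quotient_map he g) (quotient_map he f).
Proof. by apply: comod_hom_ext => x; apply: val_inj. Qed.

Definition quotient_functor : comod_functor C (corner_coalgebra he) :=
  ComodFunctor quotient_map_id quotient_map_comp.

Definition torsion (M : comodule C) : Prop := is_zero (quotient_functor M).

Definition Ie (I : Type) (S : I -> comodule C) (x : I) : Prop :=
  ~ is_zero (quotient_functor (S x)).

Record colocalizing := Colocalizing {
  coloc_functor :> comod_functor (corner_coalgebra he) C;
  coloc_adj : adjunction coloc_functor quotient_functor }.

End Quotient.

(* Main.v *)
(* Write T for the quotient functor M |-> eM and S for S_x.

   If HTS ~ S and 0 -> U -> E -> S -> 0 is an extension by a torsion simple U,
   then T(E) -> T(S) is bijective, so that Hom(HTS, E) = Hom(TS, TE) ->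
   Hom(TS, TS) = Hom(HTS, S) is bijective and the extension splits.

   Conversely it suffices, by Yoneda, that T : Hom(S, M) -> Hom(TS, TM) be
   bijective for all M.  Injectivity holds because S is simple and not torsion.
   Given phi : TS -> TM and 0 <> s in eS, let G be the subcomodule of S (+) M
   generated by (s, phi s).  Then eG lies in the graph of phi, so G -> S is onto
   with torsion kernel.  As G is finite dimensional, a nonzero kernel would have
   a maximal subcomodule L, and the splitting of the extension G/L of S by a
   torsion simple would contradict that G is generated by eG.  Hence G ~ S, and
   G is the graph of a lift of phi.

   Stable subspaces replace subcomodules: since functionals separate the
   elements of a tensor product, a subspace of M stable under C* and the
   quotient by it are comodules; both are realized as images of idempotents. *)

Require Import Defs.
From HB Require Import structures.
From mathcomp Require Import all_boot all_algebra.
From mathcomp Require Import boolp classical_sets.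

Set Implicit Arguments.
Unset Strict Implicit.
Unset Printing Implicit Defensive.

Import GRing.Theory.
Local Open Scope ring_scope.

(** * Complements, projections and functionals in vector spaces of arbitrary dimension *)

Section LinearAlgebra.
Variable K : fieldType.
Implicit Types V M N : lmodType K.

Definition submodule V (L : V -> Prop) : Prop :=
  L 0 /\ forall a u v, L u -> L v -> L (a *: u + v).

Lemma submoduleB V (L : V -> Prop) u v :
  submodule L -> L u -> L v -> L (u - v).
Proof. by move=> [_ hL] Lu Lv; rewrite addrC -scaleN1r; apply: hL. Qed.

Lemma submoduleD V (L : V -> Prop) u v :
  submodule L -> L u -> L v -> L (u + v).
Proof. by move=> [_ hL] Lu Lv; rewrite -[u]scale1r; apply: hL. Qed.

Lemma submoduleZ V (L : V -> Prop) a u : submodule L -> L u -> L (a *: u).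
Proof. by move=> [L0 hL] Lu; rewrite -[_ *: _]addr0; apply: hL. Qed.

Lemma submodule_sum V (L : V -> Prop) n (u : 'I_n -> V) :
  submodule L -> (forall i, L (u i)) -> L (\sum_i u i).
Proof.
move=> sL Lu; elim/big_ind: _ => // [|x y Lx Ly]; first exact: sL.1.
exact: submoduleD.
Qed.

(** Zorn's lemma gives a [W] maximal among the subspaces meeting [L] trivially; a vector outside
    [W + L] could be adjoined to it. *)
Lemma complement V (L : V -> Prop) : submodule L ->
  exists W : V -> Prop, [/\ submodule W, forall v, W v -> L v -> v = 0
    & forall v, exists2 w, W w & L (v - w)].
Proof.
move=> sL; have [L0 hL] := sL.
(* 0 is not required to lie in W, so that the union of the empty chain is
   admissible in Zorn's lemma. *)
pose P (W : V -> Prop) := (forall a u v, W u -> W v -> W (a *: u + v)) /\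
  (forall v, W v -> L v -> v = 0).
have [F FP Ftot|W [[hW WL] Wmax]] := @Zorn_bigcup V P.
  split=> [a u v [A FA Au] [B FB Bv]|v [A FA Av]]; last exact: (FP A FA).2.
  have [AB|BA] := Ftot A B FA FB.
    by exists B => //; apply: (FP B FB).1 => //; apply: AB.
  by exists A => //; apply: (FP A FA).1 => //; apply: BA.
have W0 : W 0.
  apply: contrapT => nW0.
  have W_empty u : ~ W u.
    by move=> Wu; apply: nW0; rewrite -(addNr u) -scaleN1r; apply: hW.
  apply: (Wmax (fun v => v = 0)); last first.
    by split=> [a u v -> ->|v ->] //; rewrite scaler0 addr0.
  by split=> [u /W_empty //|sub0]; apply: (W_empty 0); exact: sub0.
exists W; split=> // v; apply: contrapT => nv.
have {}nv w : W w -> ~ L (v - w) by move=> Ww Lw; apply: nv; exists w.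
apply: (Wmax (fun u => exists2 w, W w & exists a, u = w + a *: v)).
  split=> [w Ww|sub].
    by exists w => //; exists 0; rewrite scale0r addr0.
  apply: (nv v); last by rewrite subrr.
  by apply: sub; exists 0 => //; exists 1; rewrite scale1r add0r.
split=> [a u1 u2 [w1 W1 [b ->]] [w2 W2 [c ->]]|u [w Ww [a ->]] Lu].
  exists (a *: w1 + w2); first exact: hW.
  by exists (a * b + c); rewrite scalerDr scalerDl scalerA addrACA.
have [a0|a0] := eqVneq a 0.
  by move: Lu; rewrite a0 scale0r addr0; apply: WL.
exfalso; apply: (nv (- a^-1 *: w)); first exact: submoduleZ.
rewrite scaleNr opprK -[v]scale1r -(mulVf a0) -scalerA -scalerDr addrC.
exact: submoduleZ.
Qed.

Lemma projection_along V (L : V -> Prop) : submodule L ->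
  exists p : {linear V -> V},
    (forall v, p (p v) = p v) /\ (forall v, p v = 0 <-> L v).
Proof.
move=> sL; have [W [sW WL dec]] := complement sL; have [L0 hL] := sL.
have [p pP] : {p : V -> V & forall v, W (p v) /\ L (v - p v)}.
  apply: (choice (P := fun v w => W w /\ L (v - w))) => v.
  by have [w Ww Lw] := dec v; exists w.
have p_uniq v w : W w -> L (v - w) -> p v = w.
  move=> Ww Lw; have [Wp Lp] := pP v; apply/eqP; rewrite -subr_eq0; apply/eqP.
  apply: WL; first exact: submoduleB.
  have -> : p v - w = (v - w) - (v - p v).
    by rewrite opprB [RHS]addrC addrA subrK.
  exact: submoduleB.
have p_lin : linear p.
  move=> a u v; have [Wu Lu] := pP u; have [Wv Lv] := pP v.
  apply: p_uniq; first exact: sW.2.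
  by rewrite opprD addrACA -scalerBr; apply: hL.
pose pL := HB.pack_for {linear V -> V} p
  (GRing.isLinear.Build K V V *:%R p p_lin).
exists pL; split=> v /=.
  by apply: p_uniq; rewrite ?subrr //; case: (pP v).
split=> [pv0|Lv]; first by have [_] := pP v; rewrite pv0 subr0.
by apply: p_uniq; [exact: sW.1|rewrite subr0].
Qed.

Lemma projection_onto V (L : V -> Prop) : submodule L ->
  exists p : {linear V -> V},
    (forall v, p (p v) = p v) /\ (forall v, p v = v <-> L v).
Proof.
move=> /projection_along [q [qq qL]].
exists (idfun \- q); split=> v /=; first by rewrite linearB /= qq subrr subr0.
rewrite -qL; split=> [/eqP|->]; last by rewrite subr0.
by rewrite -subr_eq0 addrAC subrr add0r oppr_eq0 => /eqP.
Qed.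

(** A projection with kernel [L] is followed by a projection onto the line through the image [w] of
    [v]; the functional is the coordinate on that line. *)
Lemma separating_functional V (L : V -> Prop) v : submodule L -> ~ L v ->
  exists f : {scalar V}, (forall u, L u -> f u = 0) /\ f v = 1.
Proof.
move=> sL nLv; have [p [pp pL]] := projection_along sL.
pose w := p v.
have w0 : w != 0 by apply/eqP => /pL.
have sw : submodule (fun u : V => exists a : K, u = a *: w).
  split=> [|a u1 u2 [b ->] [c ->]]; first by exists 0; rewrite scale0r.
  by exists (a * b + c); rewrite scalerDl scalerA.
have [q [qq qw]] := projection_onto sw.
have [f fE] : {f : V -> K & forall u, q (p u) = f u *: w}.
  apply: (choice (P := fun u a => q (p u) = a *: w)) => u.
  by apply/qw; rewrite qq.
have w_inj (a b : K) : a *: w = b *: w -> a = b.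
  move=> /eqP; rewrite -subr_eq0 -scalerBl scaler_eq0 (negPf w0) orbF subr_eq0.
  by move/eqP.
have f_lin : scalar f.
  by move=> a x y; apply: w_inj; rewrite -fE !linearP scalerDl -scalerA !fE.
pose fL := HB.pack_for {scalar V} f (GRing.isLinear.Build K V K *%R f f_lin).
exists fL; split=> [u /pL pu0|] /=; apply: w_inj; rewrite -fE.
  by rewrite pu0 linear0 scale0r.
by rewrite scale1r; apply/qw; exists 1; rewrite scale1r.
Qed.

(** Induction on the number of terms. If [v ord0] lies in the span of the other [v i], its term is
    distributed over theirs; otherwise a functional equal to 1 on it and to 0 on the others forces
    [u ord0] to vanish. *)
Lemma fsum_tensor_separated M N n (u : 'I_n -> M) (v : 'I_n -> N) :
  (forall f : {scalar N}, \sum_i f (v i) *: u i = 0) ->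
  \sum_i u i *t v i = 0.
Proof.
elim: n => [|n IHn] in u v *; first by rewrite big_ord0.
pose v' i := v (lift ord0 i).
pose span x := exists a : 'I_n -> K, x = \sum_i a i *: v' i.
move=> h; have [[a va]|nspan] := pselect (span (v ord0)).
  have -> : \sum_i u i *t v i =
      \sum_i (u (lift ord0 i) + a i *: u ord0) *t v' i.
    rewrite big_ord_recl va linear_sum -big_split; apply: eq_bigr => i _ /=.
    by rewrite pureDl pureZl pureZr addrC.
  apply: IHn => f; rewrite -[RHS](h f) big_ord_recl va linear_sum scaler_suml.
  rewrite -big_split; apply: eq_bigr => i _ /=.
  by rewrite scalarZ scalerDr scalerA mulrC addrC.
have sspan : submodule span.
  split=> [|b x y [c ->] [d ->]].
    by exists (fun=> 0); rewrite big1 // => i _; rewrite scale0r.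
  exists (fun i => b * c i + d i); rewrite scaler_sumr -big_split.
  by apply: eq_bigr => i _; rewrite scalerDl scalerA.
have v'_span i : span (v' i).
  exists (fun j => (j == i)%:R).
  rewrite (bigD1 i) //= eqxx scale1r big1 ?addr0 //.
  by move=> j /negPf ->; rewrite scale0r.
have [f [f0 f1]] := separating_functional sspan nspan.
have u0 : u ord0 = 0.
  rewrite -[RHS](h f) big_ord_recl f1 scale1r big1 ?addr0 // => i _.
  by rewrite f0 ?scale0r //; exact: v'_span.
have pure0 : 0 *t v ord0 = 0 :> M ⊗ N by exact: (linear0 (purer _)).
rewrite big_ord_recl u0 pure0 add0r; apply: IHn => g.
by rewrite -[RHS](h g) [RHS]big_ord_recl u0 scaler0 add0r.
Qed.

(** Contracting a coaction with functionals gives the action of [C*], so colinearity can be checked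
    on [act]. *)
Lemma tensor_separated M N (s t : M ⊗ N) :
  (forall f : {scalar N}, contractr M f s = contractr M f t) -> s = t.
Proof.
move=> h; apply/eqP; rewrite -subr_eq0; apply/eqP.
have {}h f : contractr M f (s - t) = 0 by rewrite linearB /= h subrr.
rewrite (tensor_sum (s - t)) big_tnth in h *.
apply: fsum_tensor_separated => f; rewrite -[RHS](h f) linear_sum.
by apply: eq_bigr => i _ /=; rewrite contractrE.
Qed.

Definition finite_span V (N : V -> Prop) : Prop :=
  exists n (v : 'I_n -> V),
    forall m, N m -> exists r : 'rV[K]_n, m = \sum_i r 0 i *: v i.

End LinearAlgebra.

(** * Comodule structures on the image of an idempotent linear map *)

Section ProjectionComodule.
Variables (K : fieldType) (C : coalgebra K) (M : comodule C).
Variables (p : {linear M -> M}) (pp : forall m, p (p m) = p m).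
Notation F := (fixed p).
Notation pi := (fixed_proj pp).

Definition proj_coact (x : F) : F ⊗ C := tmap pi idfun (coact M (val x)).
HB.instance Definition _ := GRing.isLinear.Build K F (F ⊗ C) *:%R
  proj_coact (fun a u v => linearP (tmap pi idfun \o coact M \o val) a u v).

(** This holds both when the image of [p] is stable, which yields a subcomodule, and when its kernel
    is stable, which yields a quotient. *)
Hypothesis coact_proj : forall x : F,
  tmap (tmap pi idfun \o coact M \o p) idfun (coact M (val x))
  = tmap (tmap pi idfun \o coact M) idfun (coact M (val x)).

Fact proj_coactA x :
  tassoc _ _ _ (tmap proj_coact idfun (proj_coact x))
  = tmap idfun (comul C) (proj_coact x).
Proof.
rewrite {2 3}/proj_coact !tmap_comp.
rewrite (eq_tmap (f' := tmap pi idfun \o coact M \o p) (g' := idfun)) //.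
have -> := coact_proj x.
have -> : tmap (tmap pi idfun \o coact M) idfun (coact M (val x))
    = tmap (tmap pi idfun) idfun (tmap (coact M) idfun (coact M (val x))).
  by rewrite tmap_comp; exact: eq_tmap.
rewrite tassoc_tmap coactA tmap_comp.
by apply: eq_tmap => // c /=; rewrite tmap_id.
Qed.

Fact proj_coact_counit x : contractr _ (counit C) (proj_coact x) = x.
Proof.
rewrite contractr_tmap (eq_contractr (b := counit C)) // coact_counit.
exact: fixed_projK.
Qed.

Definition proj_comodule : comodule C := Comodule proj_coactA proj_coact_counit.

End ProjectionComodule.

(** * Subcomodules, quotient comodules and factorization of homomorphisms *)

Section Subcomodules.
Variables (K : fieldType) (C : coalgebra K).
Implicit Types M N Q : comodule C.

(* Stability under the left C*-module structure of a right comodule. *)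
Definition stable M (L : M -> Prop) : Prop :=
  submodule L /\ forall f m, L m -> L (act f m).

(** The carrier is the image of a projection [p] onto [L]; stability, tested on functionals, says
    that [p] on the left tensor factor fixes the coaction of this image. *)
Lemma subcomodule_exists M (L : M -> Prop) : stable L ->
  exists (N : comodule C) (i : comod_hom N M),
    injective i /\ forall m, L m <-> exists n, i n = m.
Proof.
move=> [sL aL]; have [p [pp pL]] := projection_onto sL.
have coact_im (x : fixed p) : tmap p idfun (coact M (val x)) = coact M (val x).
  apply: tensor_separated => f.
  rewrite contractr_tmap (eq_contractr (b := f)) //.
  by apply/pL/aL/pL; exact: fixedP.
have coact_proj (x : fixed p) :
    tmap (tmap (fixed_proj pp) idfun \o coact M \o p) idfun (coact M (val x))
    = tmap (tmap (fixed_proj pp) idfun \o coact M) idfun (coact M (val x)).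
  by rewrite -{2}coact_im tmap_comp.
have i_coact (x : proj_comodule coact_proj) :
    coact M (val x) = tmap val idfun (coact (proj_comodule coact_proj) x).
  by rewrite /= /proj_coact tmap_comp -[LHS]coact_im; apply: eq_tmap.
exists _, (ComodHom i_coact); split=> [|m]; first exact: val_inj.
split=> [/pL pm|[n <-]]; last by apply/pL; exact: fixedP.
by exists (fixed_proj pp m).
Qed.

(** The carrier is the image of a projection [p] with kernel [L]. As [m - p m] lies in [L], the
    coactions of [m] and [p m] agree after projecting the left factor. *)
Lemma quotient_exists M (L : M -> Prop) : stable L ->
  exists (Q : comodule C) (q : comod_hom M Q),
    (forall z, exists m, q m = z) /\ forall m, q m = 0 <-> L m.
Proof.
move=> [sL aL]; have [p [pp pL]] := projection_along sL.
have pi0 m : fixed_proj pp m = 0 <-> L m.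
  rewrite -pL; split=> [/(congr1 val)//|pm0]; exact: val_inj.
have coact_pi m : tmap (fixed_proj pp) idfun (coact M (p m))
    = tmap (fixed_proj pp) idfun (coact M m).
  apply: tensor_separated => f; rewrite !contractr_tmap; apply/eqP.
  rewrite -subr_eq0 -linearB; apply/eqP/pi0; rewrite -linearB /= -linearB.
  by apply: aL; apply/pL; rewrite linearB /= pp subrr.
have coact_proj (x : fixed p) :
    tmap (tmap (fixed_proj pp) idfun \o coact M \o p) idfun (coact M (val x))
    = tmap (tmap (fixed_proj pp) idfun \o coact M) idfun (coact M (val x)).
  exact: eq_tmap.
have q_coact m : coact (proj_comodule coact_proj) (fixed_proj pp m)
    = tmap (fixed_proj pp) idfun (coact M m).
  exact: coact_pi.
exists _, (ComodHom q_coact); split=> [z|] //.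
by exists (val z); exact: fixed_projK.
Qed.

Lemma stable_preim M N (h : comod_hom M N) (L : N -> Prop) :
  stable L -> stable (fun m => L (h m)).
Proof.
move=> [[L0 sL] aL]; split; last by move=> f m; rewrite hom_act; exact: aL.
by split=> [|a u v]; rewrite ?linear0 // linearP; exact: sL.
Qed.

Lemma stable_im M N (h : comod_hom M N) (L : M -> Prop) :
  stable L -> stable (fun n => exists2 m, L m & h m = n).
Proof.
move=> [[L0 sL] aL]; split; last first.
  by move=> f _ [m Lm <-]; exists (act f m); [exact: aL|exact: hom_act].
split=> [|a _ _ [u Lu <-] [v Lv <-]]; first by exists 0; rewrite ?linear0.
by exists (a *: u + v); [exact: sL|rewrite linearP].
Qed.

Lemma stable0 M : stable (fun m : M => m = 0).
Proof.
split=> [|f m ->]; last exact: linear0.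
by split=> [|a u v -> ->] //; rewrite scaler0 addr0.
Qed.

Lemma stableT M : stable (fun m : M => True).
Proof. by []. Qed.

(** A set-theoretic section [r] of [q] suffices: [r (q m)] and [m] differ by an element of the
    kernel of [q], which [h] kills. *)
Lemma hom_factor M Q N (q : comod_hom M Q) (h : comod_hom M N) :
  (forall z, exists m, q m = z) -> (forall m, q m = 0 -> h m = 0) ->
  exists g : comod_hom Q N, forall m, g (q m) = h m.
Proof.
move=> q_surj hq.
have [r rK] := choice q_surj.
have hr m : h (r (q m)) = h m.
  apply/eqP; rewrite -subr_eq0 -linearB; apply/eqP/hq.
  by rewrite linearB /= rK subrr.
pose g z := h (r z).
have g_lin : linear g.
  move=> a u v; rewrite -{1}(rK u) -{1}(rK v) -linearP /g hr.
  by rewrite linearP.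
pose gL := HB.pack_for {linear Q -> N} g
  (GRing.isLinear.Build K Q N *:%R g g_lin).
have g_coact z : coact N (gL z) = tmap gL idfun (coact Q z).
  rewrite -{2}(rK z) hom_coact tmap_comp /= /g hom_coact.
  by apply: eq_tmap => // m /=; rewrite /g hr.
by exists (ComodHom g_coact).
Qed.

Lemma hom_bij_inverse M N (h : comod_hom M N) :
  injective h -> (forall n, exists m, h m = n) ->
  exists g : comod_hom N M, cancel h g /\ cancel g h.
Proof.
move=> h_inj h_surj.
have [|g gK] := hom_factor (h := hom_id M) h_surj.
  by move=> m hm; apply: h_inj; rewrite hm linear0.
by exists g; split=> // n; have [m <-] := h_surj n; rewrite gK.
Qed.

Lemma injective_hom M N (h : comod_hom M N) :
  (forall m, h m = 0 -> m = 0) -> injective h.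
Proof.
move=> h0 u v /eqP; rewrite -subr_eq0 -linearB => /eqP /h0 /eqP.
by rewrite subr_eq0 => /eqP.
Qed.

Lemma simple_stable M (L : M -> Prop) : simple_comodule M -> stable L ->
  (forall m, L m -> m = 0) \/ (forall m, L m).
Proof.
move=> [_ sM] /subcomodule_exists [N [i [i_inj iL]]].
have [N0|i_surj] := sM N i i_inj; [left=> m /iL [n <-]|by right=> m; apply/iL].
by rewrite (N0 n) linear0.
Qed.

End Subcomodules.

(** * Maximal stable subspaces and finiteness of cyclic comodules *)

Section FiniteSpan.
Variables (K : fieldType) (C : coalgebra K) (M : comodule C).

Definition proper_stable (N L : M -> Prop) : Prop :=
  [/\ stable L, forall m, L m -> N m & exists2 m, N m & ~ L m].

(** A proper stable subspace is measured by the number of independent coordinate rows that [ev]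
    sends into it. This number is at most [n], and a subspace attaining the largest value is
    maximal. *)
Lemma maximal_stable (N : M -> Prop) :
  finite_span N -> (exists2 m, N m & m <> 0) -> stable N ->
  exists2 L, proper_stable N L & forall L', proper_stable N L' ->
    (forall m, L m -> L' m) -> forall m, L' m -> L m.
Proof.
move=> [n [v vN]] [m0 Nm0 m00] [[N0 _] _].
pose ev (r : 'rV[K]_n) := \sum_i r 0 i *: v i.
pose P k := `[< exists L (B : 'M_(k, n)),
  [/\ proper_stable N L, row_free B & forall i, L (ev (row i B))] >].
have P0 : exists k, P k.
  (* The zero subspace with the empty matrix; it is proper because [N] has a nonzero element. *)
  exists 0; apply/asboolP; exists (fun m => m = 0), 0.
  split=> [||[]] //; first by split=> [|m ->|] //; [exact: stable0|exists m0].
  by rewrite /row_free mxrank0.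
have Pn k : P k -> (k <= n)%N.
  by case/asboolP=> L [B [_ /eqP rB _]]; rewrite -rB; exact: rank_leq_col.
case: (ex_maxnP P0 Pn) => k /asboolP [L [B [pL fB LB]]] kmax.
exists L => // L' pL' LL' m L'm; apply: contrapT => nLm.
have [sL' L'N _] := pL'; have [r mr] := vN m (L'N m L'm).
have rB : ~~ (r <= B)%MS.
  apply/negP => /submxP [D rD]; apply: nLm; rewrite mr.
  have -> : \sum_i r 0 i *: v i = \sum_j D 0 j *: ev (row j B).
    under [RHS]eq_bigr do rewrite scaler_sumr.
    rewrite exchange_big; apply: eq_bigr => i _; rewrite rD mxE scaler_suml.
    by apply: eq_bigr => j _; rewrite mxE scalerA.
  have [[sL _] _ _] := pL.
  by apply: submodule_sum => // j; exact: submoduleZ.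
(* Adjoining [r] to [B] gives [k + 1] independent rows evaluating into [L'], against the maximality
   of [k]. *)
have /kmax : P (k + 1)%N; last by rewrite addn1 ltnn.
apply/asboolP; exists L', (col_mx B r); split=> // [|i].
  have ltB : (B < col_mx B r)%MS.
    rewrite /ltmx -addsmxE addsmxSl /=.
    apply: contra rB; apply: submx_trans; rewrite -addsmxE; exact: addsmxSr.
  move: (rank_ltmx ltB) (rank_leq_row (col_mx B r)).
  rewrite (eqP fB) /row_free eqn_leq => + ->.
  by apply: leq_trans; rewrite addn1.
rewrite -(splitK i); case: (split i) => j /=.
  by rewrite rowKu; exact/LL'/LB.
rewrite rowKd; have -> : row j r = r by apply/rowP => l; rewrite mxE (ord1 j).
by rewrite /ev -mr.
Qed.

Lemma cyclic_stable (g : M) : stable (fun m => exists f, m = act f g).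
Proof.
split=> [|f _ [h ->]]; last first.
  (* [f \o lact h] is the convolution product of [f] and [h]. *)
  by exists (f \o lact h); rewrite {1}/act coact_act contractr_tmap.
split=> [|a u v [f ->] [h ->]].
  exists (counit C \- counit C).
  rewrite /act (tensor_sum (coact M g)) linear_sum big1 // => p _ /=.
  by rewrite contractrE /= subrr scale0r.
exists ((f \o (a \*: idfun)) \+ h); rewrite /act.
apply: (tensor_ext (f := a \*: contractr M f \+ contractr M h)
  (g := contractr M ((f \o (a \*: idfun)) \+ h))) => m c /=.
by rewrite !contractrE /= scalarZ scalerDl scalerA.
Qed.

Lemma cyclic_generator (g : M) : exists f, g = act f g.
Proof. by exists (counit C); rewrite /act coact_counit. Qed.

(** If the coaction of [g] is a sum of [u_i ⊗ c_i], then [act f g] is the sum of the [f c_i *: u_i],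
    so the finitely many [u_i] span everything. *)
Lemma cyclic_finite_span (g : M) (N : M -> Prop) :
  (forall m, exists f, m = act f g) -> finite_span N.
Proof.
move=> cyc; pose s := repr (coact M g).
exists (size s), (fun i => (tnth (in_tuple s) i).1) => m _.
have [f ->] := cyc m.
exists (\row_i f (tnth (in_tuple s) i).2).
rewrite /act [X in contractr _ _ X]tensor_sum big_tnth linear_sum.
by apply: eq_bigr => i _ /=; rewrite contractrE mxE.
Qed.

End FiniteSpan.

(** * Colinear maps out of [C*]-linear ones, and vanishing of [Ext1] as splitting *)

Section Extensions.
Variables (K : fieldType) (C : coalgebra K).
Implicit Types M N X : comodule C.

Lemma hom_of_act M N (h : {linear M -> N}) :
  (forall f m, h (act f m) = act f (h m)) ->
  exists g : comod_hom M N, g =1 h.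
Proof.
move=> ha; suff h_coact m : coact N (h m) = tmap h idfun (coact M m).
  by exists (ComodHom h_coact).
apply: tensor_separated => f; rewrite contractr_tmap.
by rewrite -[LHS](ha f m); congr (h _); apply: eq_contractr.
Qed.

Lemma dsum_act f (N M : comodule C) (z : dsum N M) :
  act f z = (act f z.1, act f z.2).
Proof.
rewrite /act /= /dsum_coact linearD /= !contractr_tmap.
by congr pair; rewrite /= ?addr0 ?add0r; apply: eq_contractr.
Qed.

Lemma dsum_copair N M X (f : comod_hom N X) (h : comod_hom M X) :
  exists g : comod_hom (dsum N M) X, forall z, g z = f z.1 + h z.2.
Proof.
pose g (z : (N * M)%type) := f z.1 + h z.2.
have g_lin : linear g.
  by move=> a u v; rewrite /g !linearP scalerDr addrACA.
pose gL := HB.pack_for {linear dsum N M -> X} g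
  (GRing.isLinear.Build K (N * M)%type X *:%R g g_lin).
apply: (hom_of_act (h := gL)) => b z.
by rewrite dsum_act /= /g /= !hom_act linearD.
Qed.

Lemma dsum_fst_hom N M :
  exists g : comod_hom (dsum N M) N, forall z, g z = z.1.
Proof.
have [f z|g gE] := @hom_of_act (dsum N M) N (@dsum_fst K C N M).
  by rewrite dsum_act.
by exists g => z; rewrite gE.
Qed.

Lemma dsum_inr_hom N M :
  exists g : comod_hom M (dsum N M), forall m, g m = (0, m).
Proof. by exists (@ComodHom K C M (dsum N M) _ (@dsum_coact_inr K C N M)). Qed.

Lemma ext_equiv_sym M N (E F : extension M N) :
  ext_equiv E F -> ext_equiv F E.
Proof.
move=> [f [g [[fK gK] f_in f_out]]]; exists g, f; split=> // [n|z].
  by rewrite -f_in fK.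
by rewrite -f_out gK.
Qed.

Lemma ext_equiv_trans M N (E F G : extension M N) :
  ext_equiv E F -> ext_equiv F G -> ext_equiv E G.
Proof.
move=> [f [f' [[fK f'K] f_in f_out]]] [g [g' [[gK g'K] g_in g_out]]].
exists (hom_comp g f), (hom_comp f' g'); split=> [|n|z] /=.
- by split=> z /=; rewrite ?gK ?fK // f'K g'K.
- by rewrite f_in g_in.
- by rewrite g_out f_out.
Qed.

Definition has_section M N (h : comod_hom M N) : Prop :=
  exists s : comod_hom N M, cancel s h.

Lemma section_split M N (E : extension M N) :
  has_section (ext_out E) -> ext_equiv E (split_extension M N).
Proof.
move=> [s sK]; have [g gE] := dsum_copair (ext_in E) s.
have out_in n : ext_out E (ext_in E n) = 0 by apply/ext_exact; exists n.
have out_g z : ext_out E (g z) = z.2 by rewrite gE linearD out_in add0r sK.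
have [|z|f [fK gK]] := hom_bij_inverse (h := g).
- apply: injective_hom => -[n m] /= g0.
  have m0 : m = 0 by rewrite -[m](out_g (n, m)) g0 linear0.
  rewrite m0; congr pair; apply: (@ext_in_inj _ _ _ _ E).
  by rewrite linear0 -g0 gE m0 /= linear0 addr0.
- have /ext_exact [n nE] : ext_out E (z - s (ext_out E z)) = 0.
    by rewrite linearB /= sK subrr.
  by exists (n, ext_out E z); rewrite gE nE subrK.
apply: ext_equiv_sym; exists g, f; split=> // n.
by rewrite gE /= linear0 addr0.
Qed.

(** An equivalence with the split extension turns the inclusion of [M] into a section. Conversely,
    an extension with a section is equivalent to the split one, so the two classes coincide as
    predicates. *)
Lemma Ext1_eq0P M N :
  Ext1_eq0 M N <-> forall E : extension M N, has_section (ext_out E).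
Proof.
split=> [h E | h [X [E XE]]].
  have /(congr1 sval) /= EX := h (ext_class E).
  have [f [g [[fK gK] _ f_out]]] : ext_equiv E (split_extension M N).
    by rewrite EX; exists (hom_id _), (hom_id _).
  have [r rE] := dsum_inr_hom N M.
  exists (hom_comp g r) => m /=.
  by rewrite -f_out gK /= rE.
apply: eq_exist => /=; rewrite {X}XE; apply/funext => F; apply/propext.
have ES := section_split (h E).
split; first exact: ext_equiv_trans (ext_equiv_sym ES).
exact: ext_equiv_trans ES.
Qed.

(** The middle term and [ext_out E] are kept; only the kernel inclusion is composed with the
    isomorphism from [N] to [U]. *)
Lemma section_of_Ext1_eq0 M N U (E : extension M U) :
  comod_iso U N -> Ext1_eq0 M N -> has_section (ext_out E).
Proof.
move=> [a [b [aK bK]]] /Ext1_eq0P h.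
have in_inj : injective (hom_comp (ext_in E) b).
  exact: inj_comp (@ext_in_inj _ _ _ _ E) (can_inj bK).
have exact_E z : ext_out E z = 0 <-> exists n, hom_comp (ext_in E) b n = z.
  rewrite ext_exact; split=> -[n <-]; last by exists (b n).
  by exists (a n); rewrite /= aK.
exact: (h (Extension in_inj (@ext_out_surj _ _ _ _ E) exact_E)).
Qed.

End Extensions.

(** * Surjections with torsion kernel from a comodule generated by an element fixed by [e] *)

Section TorsionKernel.
Variables (K : fieldType) (C : coalgebra K) (e : {scalar C}).
Variables (G S : comodule C) (out : comod_hom G S) (g0 : G).
Hypothesis g0_cyclic : forall g, exists f, g = act f g0.
Hypothesis eg0 : act e g0 = g0.
Hypothesis out_surj : forall s, exists g, out g = s.
Hypothesis ker_torsion : forall z, out z = 0 -> act e z = 0.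
Hypothesis ext_split : forall U : comodule C, simple_comodule U ->
  (forall u : U, act e u = 0) ->
  forall E : extension S U, has_section (ext_out E).

Lemma torsion_ker_injective : injective out.
Proof.
apply: injective_hom => z0 out_z0; apply: contrapT => z00.
have [|L [sL LN [m Nm nLm]] Lmax] :=
  @maximal_stable _ _ G _ (cyclic_finite_span _ g0_cyclic) _
    (stable_preim out (stable0 S)); first by exists z0.
(* [Q] is [G/L], and [U] below is the kernel of the map [o : Q -> S] induced by [out]. *)
have [Q [q [q_surj q0]]] := quotient_exists sL.
have [|o oq] := hom_factor (h := out) q_surj; first by move=> z /q0 /LN.
have [U [i [i_inj iU]]] := subcomodule_exists (stable_preim o (stable0 S)).
have simpleU : simple_comodule U.
  split=> [U0|X j j_inj].
    have /iU [u iu] : o (q m) = 0 by rewrite oq.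
    by apply/nLm/q0; rewrite -iu (U0 u) linear0.
  (* A subcomodule [X] of [U] pulls back to a stable [L'] between [L] and the kernel of [out]; by
     maximality of [L] it is one of the two. *)
  pose L' z := exists2 x, True & hom_comp i j x = q z.
  have sL' : stable L'.
    exact (stable_preim q (stable_im (hom_comp i j) (stableT X))).
  have L'N z : L' z -> out z = 0.
    by move=> [x _ ijx]; rewrite -oq -ijx; apply/iU; exists (j x).
  have [NL'|nNL'] := pselect (forall z, out z = 0 -> L' z).
    right=> u; have [z qz] := q_surj (i u).
    have [|x _ ijx] := NL' z; first by rewrite -oq qz; apply/iU; exists u.
    by exists x; apply: i_inj; rewrite -qz.
  left=> x; apply: j_inj; apply: i_inj; rewrite !linear0.
  have [z qz] := q_surj (i (j x)); rewrite -qz; apply/q0.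
  apply: (Lmax L'); last by exists x.
    split=> //; apply: contrapT => h; apply: nNL' => y outy.
    by apply: contrapT => nL'y; apply: h; exists y.
  by move=> y /q0 qy; exists 0; rewrite ?qy ?linear0.
have torsionU (u : U) : act e u = 0.
  apply: i_inj; rewrite linear0 hom_act; have [z qz] := q_surj (i u).
  rewrite -qz -hom_act ker_torsion ?linear0 // -oq qz.
  by apply/iU; exists u.
have o_surj s : exists z, o z = s.
  by have [g <-] := out_surj s; exists (q g).
have [s sK] := ext_split simpleU torsionU (Extension i_inj o_surj iU).
(* The difference of the two sides lies in [U]: it is fixed by [e] because [g0] is, and killed by
   [e] because [U] is torsion. *)
have qg0 : q g0 = s (o (q g0)).
  apply/eqP; rewrite -subr_eq0; apply/eqP.
  have /iU [u iu] : o (q g0 - s (o (q g0))) = 0 by rewrite linearB /= sK subrr.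
  rewrite -iu -[RHS](linear0 i) -(torsionU u) !hom_act iu.
  by rewrite linearB /= -!hom_act eg0.
(* Since [m] is [act f g0], the identity for [q g0] carries over to [q m = s (out m) = 0], which
   puts [m] in [L]. *)
have [f mE] := g0_cyclic m.
apply/nLm/q0; rewrite mE hom_act qg0 -!hom_act -mE oq Nm.
exact: linear0.
Qed.

End TorsionKernel.

(** * The quotient functor on homomorphisms: faithfulness, lifting and torsion extensions *)

Section QuotientFunctor.
Variables (K : fieldType) (C : coalgebra K).
Variables (e : {scalar C}) (he : conv_idempotent e).
Notation T := (quotient_functor he).
Implicit Types M N S : comodule C.

Lemma torsion_act M : torsion he M <-> forall m : M, act e m = 0.
Proof.
split=> [tM m|tM m]; last first.
  by apply: val_inj; have := fixedP m; rewrite /= tM => <-.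
exact: (congr1 val (tM (fixed_proj (act_idem he (M := M)) m))).
Qed.

(** [f \o lact g] is the convolution product of [f] and [g]; [g \o ract f], used in [act_compr], is
    the same functional. *)
Lemma act_compl (f g : {scalar C}) M (m : M) :
  act f (act g m) = act (f \o lact g) m.
Proof. by rewrite {1}/act coact_act contractr_tmap. Qed.

Lemma act_compr (f g : {scalar C}) M (m : M) :
  act f (act g m) = act (g \o ract f) m.
Proof.
by rewrite act_compl; apply: eq_contractr => c /=; rewrite -conv_lact conv_ract.
Qed.

(* f, seen in the dual of eCe, acts on eM as the element e f e of C*. *)
Lemma corner_act M (f : {scalar C}) (x : quotient_obj he M) :
  val (act (C := corner_coalgebra he) (f \o val) x) = act e (act f (val x)).
Proof.
have ex : act e (val x) = val x by exact: fixedP.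
have -> : act (C := corner_coalgebra he) (f \o val) x
    = fixed_proj (act_idem he (M := M)) (act (f \o corner e) (val x)).
  apply: etrans (contractr_tmap _ _ _ _) _.
  by congr (fixed_proj _ _); apply: eq_contractr.
rewrite -[in RHS]ex [LHS]/= (act_compl f).
rewrite [LHS](act_compr e (f \o corner e)) act_compr.
by apply: eq_contractr => c /=; rewrite corner_ract.
Qed.

(** The restriction of [f] to [eCe] acts as [e f e], so [phi] commutes with it. Giving [y] by its
    value avoids naming a proof of membership in [eM]. *)
Lemma quotient_hom_act M N (phi : comod_hom (T M) (T N)) (f : {scalar C})
    (x y : T M) : val y = act e (act f (val x)) ->
  val (phi y) = act e (act f (val (phi x))).
Proof.
rewrite -corner_act => /val_inj ->; rewrite -corner_act.
by rewrite (hom_act (C := corner_coalgebra he) (f \o val) phi).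
Qed.

(** The equalizer of [f] and [g] is stable and contains the nonzero [eS], so by simplicity it is all
    of [S]. *)
Lemma quotient_simple_faithful S M (f g : comod_hom S M) :
  simple_comodule S -> ~ torsion he S ->
  fmap T f = fmap T g -> f = g.
Proof.
move=> simpleS nS fg; apply: comod_hom_ext => s.
have sL : stable (fun s => f s = g s).
  split=> [|h m]; last by rewrite !hom_act => ->.
  by split=> [|a u v]; rewrite ?linear0 // !linearP => -> ->.
have [L0|] := simple_stable simpleS sL; last by move=> ->.
case: nS => x; apply: val_inj; apply: L0.
exact (congr1 (fun h : comod_hom (T S) (T M) => val (h x)) fg).
Qed.

Section Lift.
Variables (S M : comodule C).
Hypotheses (simpleS : simple_comodule S) (nS : ~ torsion he S).
Hypothesis ext_split : forall U : comodule C, simple_comodule U ->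
  (forall u : U, act e u = 0) ->
  forall E : extension S U, has_section (ext_out E).

Lemma quotient_lift (phi : comod_hom (T S) (T M)) :
  exists f : comod_hom S M, fmap T f = phi.
Proof.
have [s0 s00] : exists s0 : T S, s0 <> 0.
  apply: contrapT => h; apply: nS => s.
  by apply: contrapT => s0; apply: h; exists s.
pose A := dsum S M; pose a0 : A := (val s0, val (phi s0)).
have [pr1 pr1E] := dsum_fst_hom S M; pose pr2 := dsum_snd_hom S M.
have [G [i [i_inj iG]]] := subcomodule_exists (cyclic_stable a0).
have /iG [g0 ig0] := cyclic_generator a0.
have cyc g : exists f, g = act f g0.
  have /iG [f ig] : exists g', i g' = i g by exists g.
  by exists f; apply: i_inj; rewrite ig hom_act ig0.
pose p1 := hom_comp pr1 i; pose p2 := hom_comp pr2 i.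
(* Every element of [G] is some [act f g0], and [phi] commutes with [e f] on [eS]; hence [eG] lies
   in the graph of [phi]. *)
have graph g : exists s : T S,
    p1 (act e g) = val s /\ p2 (act e g) = val (phi s).
  have [f ->] := cyc g.
  exists (fixed_proj (act_idem he (M := S)) (act f (val s0))).
  rewrite (@quotient_hom_act S M phi f s0) // !hom_act.
  by rewrite -[p1 g0]/(pr1 (i g0)) -[p2 g0]/(pr2 (i g0)) ig0 pr1E.
have i_pair g : i g = (p1 g, p2 g) by rewrite /p1 /= pr1E; case: (i g).
have eg0 : act e g0 = g0.
  apply: i_inj; rewrite !hom_act ig0 dsum_act /a0 /=.
  by congr pair; exact: fixedP.
have p1_surj s : exists g, p1 g = s.
  have [L0|] := simple_stable simpleS (stable_im p1 (stableT G)).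
    case: s00; apply: val_inj; apply: L0; exists g0 => //.
    by rewrite /p1 /= ig0 pr1E.
  by move=> /(_ s) [g _ <-]; exists g.
have ker_torsion g : p1 g = 0 -> act e g = 0.
  move=> p1g; have [s [s1 s2]] := graph g.
  have s_0 : s = 0 by apply: val_inj; rewrite -s1 hom_act p1g linear0.
  by apply: i_inj; rewrite linear0 i_pair s1 s2 s_0 !linear0.
have p1_inj := torsion_ker_injective cyc eg0 p1_surj ker_torsion ext_split.
have [q [p1K qK]] := hom_bij_inverse p1_inj p1_surj.
(* With [p1] bijective, [G] is the graph of [p2 \o q], which agrees with [phi] on [eS] because [eG]
   lies in the graph of [phi]. *)
exists (hom_comp p2 q); apply: comod_hom_ext => s; apply: val_inj => /=.
have [s' [s1 s2]] := graph (q (val s)).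
have es : act e (val s) = val s by exact: fixedP.
have ss' : s = s' by apply: val_inj; rewrite -s1 hom_act qK.
by rewrite -[RHS]/(val (phi s)) ss' -s2 -hom_act -ss' es.
Qed.

End Lift.

(** [T] makes [ext_out E] bijective: a kernel element comes from [U] and is fixed by [e], hence
    zero, and any preimage of an element of [eS] can be replaced by its image under [e]. *)
Lemma quotient_torsion_ext_section S U (E : extension S U) :
  (forall u : U, act e u = 0) -> exists g : comod_hom (T S) (T (ext_mid E)),
    hom_comp (fmap T (ext_out E)) g = hom_id (T S).
Proof.
move=> tU; have [||g [_ gK]] := hom_bij_inverse (h := fmap T (ext_out E)).
- apply: injective_hom => z /(congr1 val) /= /ext_exact [u uz].
  have ez : act e (val z) = val z by exact: fixedP.
  by apply: val_inj; rewrite -[LHS]ez -[val z]uz -hom_act tU linear0.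
- move=> s; have [z zs] := ext_out_surj E (val s).
  exists (fixed_proj (act_idem he (M := ext_mid E)) z); apply: val_inj.
  by rewrite /= hom_act zs; exact: fixedP.
by exists g; apply: comod_hom_ext => s; exact: gK.
Qed.

End QuotientFunctor.

(** * Isomorphisms and sections obtained through the adjunction *)

Section Adjunction.
Variables (K : fieldType) (C D : coalgebra K).
Variables (H : comod_functor D C) (T : comod_functor C D).
Variable adj : adjunction H T.

Lemma hom_comp1 (M N : comodule C) (f : comod_hom M N) :
  hom_comp f (hom_id M) = f.
Proof. exact: comod_hom_ext. Qed.

Lemma adj_natr N M M' (g : comod_hom M M') (f : comod_hom (H N) M) :
  adj_fun adj (hom_comp g f) = hom_comp (fmap T g) (adj_fun adj f).
Proof.
have := adj_nat adj (hom_id N) g f; rewrite fmap_id hom_comp1 => ->.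
exact: comod_hom_ext.
Qed.

Lemma adj_surj N M (g : comod_hom N (T M)) :
  exists f : comod_hom (H N) M, adj_fun adj f = g.
Proof. by have [k _ kK] := adj_bij adj N M; exists (k g). Qed.

Lemma adj_inj N M : injective (@adj_fun _ _ _ _ _ adj N M).
Proof. exact: bij_inj (adj_bij adj N M). Qed.

(* Yoneda: if T : Hom(S, M) -> Hom(TS, TM) is bijective for all M, then
   S represents the same functor as HTS. *)
Lemma adjoint_iso (S : comodule C) :
  (forall f g : comod_hom S S, fmap T f = fmap T g -> f = g) ->
  (forall M (phi : comod_hom (T S) (T M)),
     exists f : comod_hom S M, fmap T f = phi) ->
  comod_iso (H (T S)) S.
Proof.
(* [eps] is the counit of the adjunction at [S], and [u] lifts the unit [T S -> T (H (T S))]. *)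
move=> faithful lift; have [eps epsE] := adj_surj (hom_id (T S)).
have [u uE] := lift _ (adj_fun adj (hom_id (H (T S)))).
exists eps, u; split=> z.
  suff: hom_comp u eps = hom_id _.
    by move=> /(congr1 (fun h : comod_hom _ _ => h z)).
  by apply: adj_inj; rewrite adj_natr epsE uE; exact: comod_hom_ext.
suff: hom_comp eps u = hom_id _.
  by move=> /(congr1 (fun h : comod_hom _ _ => h z)).
by apply: faithful; rewrite fmap_comp fmap_id uE -adj_natr hom_comp1.
Qed.

(** Let [k] be the map whose adjoint is [g] after the adjoint of [a]. Naturality gives
    [out \o k = a], so [k \o b] is a section. *)
Lemma section_of_adjoint_iso (S M : comodule C) (out : comod_hom M S)
    (g : comod_hom (T S) (T M)) :
  comod_iso (H (T S)) S -> hom_comp (fmap T out) g = hom_id (T S) ->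
  has_section out.
Proof.
move=> [a [b [_ bK]]] outg.
have [k kE] := adj_surj (hom_comp g (adj_fun adj a)).
have out_k : hom_comp out k = a.
  apply: adj_inj; rewrite adj_natr kE; apply: comod_hom_ext => z /=.
  exact (congr1 (fun h : comod_hom _ _ => h (adj_fun adj a z)) outg).
by exists (hom_comp k b) => s /=; rewrite -[RHS](bK s) -out_k.
Qed.

End Adjunction.

Theorem theorem5p3 (K : fieldType) (C : coalgebra K) (hC : basic_coalgebra C)
    (I : Type) (S : I -> comodule C) (hS : complete_simples S)
    (hconn : ext_quiver_connected S)
    (e : {scalar C}) (he : conv_idempotent e) (H : colocalizing he)
    (x : I) (hx : Ie he S x) :
  (comod_iso (H (quotient_functor he (S x))) (S x) <->
     forall y : I, ~ Ie he S y -> Ext1_eq0 (S x) (S y)) /\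
  (comod_iso (H (quotient_functor he (S x))) (S x) <->
     ~ exists y : I, torsion he (S y) /\ ext_arrow S x y).
Proof.
have [simpleS _ exhaust] := hS.
have main : comod_iso (H (quotient_functor he (S x))) (S x) <->
    forall y : I, ~ Ie he S y -> Ext1_eq0 (S x) (S y).
  split=> [iso y /contrapT /torsion_act tSy|ext0].
    apply/Ext1_eq0P => E; have [g gE] := quotient_torsion_ext_section he E tSy.
    exact (section_of_adjoint_iso (coloc_adj H) iso gE).
  apply: (adjoint_iso (coloc_adj H)) => [f g|M phi].
    exact: quotient_simple_faithful (simpleS x) hx.
  apply: quotient_lift => // U simpleU tU E.
  (* Vanishing is assumed for the members of the family [S] only, so the torsion simple [U] is
     replaced by an isomorphic [S y]. *)
  have [y [a [b [aK bK]]]] := exhaust U simpleU.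
  apply: (@section_of_Ext1_eq0 _ _ _ (S y)); first by exists a, b.
  apply: ext0 => nSy; apply: nSy; apply/torsion_act => s.
  by rewrite -(bK s) -hom_act tU linear0.
split=> //; rewrite main; split=> [ext0 [y [tSy]]|h y nSy].
  by apply; apply: ext0; apply.
apply: contrapT => nE; apply: h; exists y; split=> //; exact: contrapT.
Qed.
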